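(* Let $B={}_{T_l}^{S}[T_a,T_b,T_c]_{T_r}^{S}$ and $B'={}_{T'_l}^{S'}[T'_a,T'_b,T'_c]_{T'_r}^{S'}$ be trivial braids representing two adjacent (actively-interacting) braids, $B$ on the left of $B'$, that satisfy the interaction condition: $T_r+T'_l$ is even if $S'=S$, and $T_r+T'_l$ is odd if $S'=-S$. Then the result $B+B'$ of the interaction does not depend on the choice of the braid being simultaneously rotated. That is, with $T:=T_r+T'_l$, both connected sums below are defined and they are equivalent: $${}_{T_l}^{S}[T_a,T_b,T_c]_{0}^{S}\ \#\ R_{-T,T}\left({}_{T}^{S'}[T'_a,T'_b,T'_c]_{T'_r}^{S'}\right)\ \cong\ R_{T,-T}\left({}_{T_l}^{S}[T_a,T_b,T_c]_{T}^{S}\right)\ \#\ {}_{0}^{S'}[T'_a,T'_b,T'_c]_{T'_r}^{S'} .$$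
   Context: States are signs $S\in\{+,-\}$; $\bar S=-S$ is the opposite sign, and $(-)^nS$ equals $S$ if $n$ is even and $\bar S$ if $n$ is odd. A trivial braid (with both end-nodes in the same state, as is the case for every trivial diagram of an actively-interacting braid) is a symbol $${}_{T_l}^{S}[T_a,T_b,T_c]_{T_r}^{S},$$ i.e. the data of a common end-node state $S\in\{+,-\}$, a left external twist $T_l\in\mathbb{Z}$, a right external twist $T_r\in\mathbb{Z}$, and an ordered triple of internal twists $[T_a,T_b,T_c]\in\mathbb{Z}^3$. Triples are added componentwise. A permutation $\sigma\in S_3$ acts on a triple by moving the entry in position $i$ to position $\sigma(i)$; products act from right to left. The permutations $P^S_n$ are defined by $P^S_0=\mathds{1}$, $P^+_{+1}=(1\ 2)$, $P^+_{-1}=(2\ 3)$, $P^-_{+1}=(2\ 3)$, $P^-_{-1}=(1\ 2)$, and, for $k\ge1$ and each choice of sign, $P^S_{\pm k}=P^{(-)^{k-1}S}_{\pm1}P^S_{\pm(k-1)}$. The simultaneous rotation $R_{n,-n}$, $n\in\mathbb{Z}$, is the map on trivial braids $$R_{n,-n}\left({}_{T_l}^{S}[T_a,T_b,T_c]_{T_r}^{S}\right)={}_{T_l+n}^{(-)^nS}[P^S_n(T_a,T_b,T_c)]_{T_r-n}^{(-)^nS}.$$ Two trivial braids are equivalent, written $\cong$, if one is obtained from the other by some simultaneous rotation $R_{n,-n}$, $n\in\mathbb{Z}$. The connected sum $B\# B'$ of $B={}_{T_l}^{S}[T_a,T_b,T_c]_{T_r}^{S}$ and $B'={}_{T'_l}^{S'}[T'_a,T'_b,T'_c]_{T'_r}^{S'}$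 is defined exactly when $S=S'$ and $T_r+T'_l=0$, and then $$B\# B'={}_{T_l}^{S}[T_a+T'_a,\,T_b+T'_b,\,T_c+T'_c]_{T'_r}^{S}.$$ Interaction: when $B$ (left) and $B'$ (right) are adjacent, they share a common external edge carrying the total twist $T=T_r+T'_l$, which may be attributed entirely to $B$ or entirely to $B'$. To form $B+B'$, one braid is simultaneously rotated so that the common edge becomes twist-free and the adjacent end-nodes are in the same state, and then the connected sum is taken. Rotating $B'$ (carrying all of the twist $T$) uses $R_{-T,T}$; rotating $B$ (carrying all of the twist $T$) uses $R_{T,-T}$. *)

(* Defs.v *)
From HB Require Import structures.
From mathcomp Require Import all_boot all_order all_algebra all_fingroup.

Set Implicit Arguments.
Unset Strict Implicit.
Unset Printing Implicit Defensive.

Import GRing.Theory.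
Local Open Scope ring_scope.

Inductive sign := Plus | Minus.

Definition bool_of_sign (S : sign) : bool := if S is Minus then true else false.
Definition sign_of_bool (b : bool) : sign := if b then Minus else Plus.
Lemma bool_of_signK : cancel bool_of_sign sign_of_bool.
Proof. by case. Qed.
HB.instance Definition _ := Equality.copy sign (can_type bool_of_signK).

Definition opp_sign (S : sign) : sign := if S is Plus then Minus else Plus.

Definition oddz (n : int) : bool := odd `|n|%N.

(* The sign (-)^n S. *)
Definition sign_pow (n : int) (S : sign) : sign :=
  if oddz n then opp_sign S else S.

Definition triple : Type := {ffun 'I_3 -> int}.
Definition mk_triple (a b c : int) : triple :=
  [ffun i : 'I_3 => [:: a; b; c]`_i].

(* Positions 1, 2, 3 of a triple are the ordinals 0, 1, 2. *)
Definition pos1 : 'I_3 := @Ordinal 3 0 isT.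
Definition pos2 : 'I_3 := @Ordinal 3 1 isT.
Definition pos3 : 'I_3 := @Ordinal 3 2 isT.

(* The entry of t in position i is moved to position s i. *)
Definition perm_act (s : 'S_3) (t : triple) : triple :=
  [ffun j : 'I_3 => t ((s^-1)%g j)].

(* P^S_{+1} for e = Plus and P^S_{-1} for e = Minus. *)
Definition rot_perm1 (e S : sign) : 'S_3 :=
  match e, S with
  | Plus, Plus => tperm pos1 pos2
  | Minus, Plus => tperm pos2 pos3
  | Plus, Minus => tperm pos2 pos3
  | Minus, Minus => tperm pos1 pos2
  end.

(* P^S_{+k} for e = Plus and P^S_{-k} for e = Minus. The permutation product
   of the library applies its left factor first, so the product
   P^{(-)^k S}_{+-1} P^S_{+-k}, which acts from right to left, has its
   factors reversed here. *)
Fixpoint rot_perm_nat (e S : sign) (k : nat) : 'S_3 :=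
  if k is k'.+1
  then (rot_perm_nat e S k' * rot_perm1 e (sign_pow k'%:Z S))%g
  else 1%g.

(* P^S_n; note that Negz k is the integer -(k + 1). *)
Definition rot_perm (S : sign) (n : int) : 'S_3 :=
  match n with
  | Posz k => rot_perm_nat Plus S k
  | Negz k => rot_perm_nat Minus S k.+1
  end.

(* A trivial braid whose two end-nodes are in the same state. *)
Record tbraid := TBraid {
  ltwist : int;
  state : sign;
  itwists : triple;
  rtwist : int
}.

(* rotate n is the simultaneous rotation R_{n,-n}; R_{-n,n} is rotate (- n). *)
Definition rotate (n : int) (B : tbraid) : tbraid :=
  TBraid (ltwist B + n) (sign_pow n (state B))
         (perm_act (rot_perm (state B) n) (itwists B)) (rtwist B - n).

Definition braid_equiv (B B' : tbraid) : Prop :=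
  exists n : int, B' = rotate n B.

(* Connected sum; None when it is undefined. *)
Definition connected_sum (B B' : tbraid) : option tbraid :=
  if (state B == state B') && (rtwist B + ltwist B' == 0)
  then Some (TBraid (ltwist B) (state B) (itwists B + itwists B') (rtwist B'))
  else None.

(* Main.v *)
(** The rotations satisfy [R_{-T,T} R_{T,-T} = id], because [P^{(-)^T S}_{-T}] is
    the inverse of [P^S_T]: the generators [P^{-S}_{∓1} = P^S_{±1}] are
    transpositions and the product defining [P^{(-)^T S}_{-T}] lists those of
    [P^S_T] in the reverse order. Hence [R_{T,-T}], which acts linearly on the
    internal twists, carries the first connected sum to the second. *)
Require Import Defs.
From mathcomp Require Import all_boot all_order all_algebra all_fingroup.

Import GRing.Theory.
Local Open Scope ring_scope.

Lemma opp_signK : involutive opp_sign.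
Proof. by case. Qed.

Lemma oddzN (n : int) : oddz (- n) = oddz n.
Proof. by rewrite /oddz abszN. Qed.

Lemma sign_powN (n : int) (S : sign) : sign_pow (- n) S = sign_pow n S.
Proof. by rewrite /sign_pow oddzN. Qed.

Lemma sign_powK (n : int) : involutive (sign_pow n).
Proof. by move=> S; rewrite /sign_pow; case: (oddz n); rewrite ?opp_signK. Qed.

Lemma sign_powS (k : nat) (S : sign) :
  sign_pow k.+1%:Z S = opp_sign (sign_pow k%:Z S).
Proof. by rewrite /sign_pow /oddz /=; case: (odd k); case: S. Qed.

Lemma sign_pow_opp (n : int) (S : sign) :
  sign_pow n (opp_sign S) = opp_sign (sign_pow n S).
Proof. by rewrite /sign_pow; case: ifP. Qed.

Lemma rot_perm1_opp (e S : sign) :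
  rot_perm1 (opp_sign e) (opp_sign S) = rot_perm1 e S.
Proof. by case: e; case: S. Qed.

Lemma rot_perm1V (e S : sign) : ((rot_perm1 e S)^-1)%g = rot_perm1 e S.
Proof. by case: e; case: S; apply: tpermV. Qed.

(** The definition splits off the generator applied last. Splitting off the one applied first lets
    an inverse product be unwound from its other end. *)
Lemma rot_perm_nat_recl (e S : sign) (k : nat) :
  rot_perm_nat e S k.+1 =
    (rot_perm1 e S * rot_perm_nat e (opp_sign S) k)%g.
Proof.
elim: k => [|k IHk]; first by rewrite /= mulg1 mul1g.
rewrite [LHS]/= -/(rot_perm_nat e S k.+1) IHk -mulgA /=.
by rewrite sign_powS sign_pow_opp.
Qed.

Lemma rot_perm_natV (e S : sign) (k : nat) :
  rot_perm_nat (opp_sign e) (sign_pow k%:Z S) k = ((rot_perm_nat e S k)^-1)%g.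
Proof.
elim: k => [|k IHk]; first by rewrite invg1.
(* After its first generator the reversed product continues from [sign_pow k S], as the induction
   hypothesis requires. *)
by rewrite rot_perm_nat_recl sign_powS opp_signK rot_perm1_opp IHk invMg
  rot_perm1V.
Qed.

Lemma rot_permV (S : sign) (n : int) :
  rot_perm (sign_pow n S) (- n) = ((rot_perm S n)^-1)%g.
Proof.
(* Zero is separate because its opposite is again a [Posz]; any other opposite switches constructor,
   hence the sign [e]. *)
case: n => [[|k]|k]; first by rewrite oppr0 invg1.
  exact: (rot_perm_natV Plus S k.+1).
rewrite NegzE opprK sign_powN; exact: (rot_perm_natV Minus S k.+1).
Qed.

Lemma perm_actD (s : 'S_3) (t u : triple) :
  perm_act s (t + u) = perm_act s t + perm_act s u.
Proof. by apply/ffunP=> i; rewrite !ffunE. Qed.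

Lemma perm_actKV (s : 'S_3) (t : triple) : perm_act s (perm_act s^-1%g t) = t.
Proof. by apply/ffunP=> i; rewrite !ffunE invgK permKV. Qed.

(** As there are only two signs, the two parity conditions merge into one equation, which eliminates
    [S']. *)
Lemma interaction_state (S S' : sign) (T : int)
  (Heven : S' = S -> ~~ oddz T) (Hodd : S' = opp_sign S -> oddz T) :
  S' = sign_pow T S.
Proof.
rewrite /sign_pow; case: S S' Heven Hodd => -[] Heven Hodd;
  by [rewrite Hodd | rewrite (negbTE (Heven _))].
Qed.

Theorem theorem1 (S S' : sign) (Tl Tr Ta Tb Tc Tl' Tr' Ta' Tb' Tc' : int)
  (Heven : S' = S -> ~~ oddz (Tr + Tl'))
  (Hodd : S' = opp_sign S -> oddz (Tr + Tl')) :
  let T := Tr + Tl' in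
  exists C C' : tbraid,
    [/\ connected_sum
          (TBraid Tl S (mk_triple Ta Tb Tc) 0)
          (rotate (- T) (TBraid T S' (mk_triple Ta' Tb' Tc') Tr')) = Some C,
        connected_sum
          (rotate T (TBraid Tl S (mk_triple Ta Tb Tc) T))
          (TBraid 0 S' (mk_triple Ta' Tb' Tc') Tr') = Some C'
      & braid_equiv C C'].
Proof.
move=> T; rewrite (@interaction_state S S' T Heven Hodd).
rewrite /connected_sum /rotate /= sign_powN sign_powK !eqxx !subrr !eqxx /=.
(* The left twists [Tl] and [Tl + T] of the two sums force the rotation by [T]. *)
do 2 eexists; split; [by [] | by [] | exists T].
by rewrite /rotate /= perm_actD rot_permV perm_actKV opprK addrK.
Qed.
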